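(* Let $\mathcal K$ and $\varpi(\cdot)$ be as in the context and $U\in\mathbb S^n_{\succeq0}$, $n\in\mathbb N$. Let $\mathbf f(\cdot)\in\mathcal L^2_\varpi(\mathcal K;\mathbb R^d)$ and $\mathbf g(\cdot)\in\mathcal L^2_\varpi(\mathcal K;\mathbb R^\delta)$, $d\in\mathbb N$, $\delta\in\mathbb N_0$, satisfy $$\int_{\mathcal K}\varpi(\tau)\begin{bmatrix}\mathbf g(\tau)\\ \mathbf f(\tau)\end{bmatrix}\begin{bmatrix}\mathbf g^\top(\tau)&\mathbf f^\top(\tau)\end{bmatrix}d\tau\succ0 .$$ Then for all $\boldsymbol x(\cdot)\in\mathcal L^2_\varpi(\mathcal K;\mathbb R^n)$, $$\int_{\mathcal K}\varpi\,\boldsymbol x^\top U\boldsymbol x\,d\tau\ \ge\ \int_{\mathcal K}\varpi\,\boldsymbol x^\top\mathsf F^\top d\tau\,(\mathcal F_d\otimes U)\int_{\mathcal K}\varpi\,\mathsf F\boldsymbol x\,d\tau+\int_{\mathcal K}\varpi\,\boldsymbol x^\top\mathsf E^\top d\tau\,(\mathcal E_d^{-1}\otimes U)\int_{\mathcal K}\varpi\,\mathsf E\boldsymbol x\,d\tau,$$ where $\mathsf F(\tau)=\mathbf f(\tau)\otimes I_n$, $\mathcal F_d^{-1}=\int_{\mathcal K}\varpi\,\mathbf f\mathbf f^\top d\tau\in\mathbb S^d_{\succ0}$, $\mathsf E(\tau)=\boldsymbol e(\tau)\otimes I_n$, $\mathcal E_d=\int_{\mathcal K}\varpi\,\boldsymbol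 e\boldsymbol e^\top d\tau\in\mathbb S^\delta$, $\boldsymbol e(\tau)=\mathbf g(\tau)-\mathsf A\mathbf f(\tau)\in\mathbb R^\delta$ and $\mathsf A=\left(\int_{\mathcal K}\varpi\,\mathbf g\mathbf f^\top d\tau\right)\mathcal F_d\in\mathbb R^{\delta\times d}$.
   Context: $\mathcal K\subseteq\mathbb R\cup\{\pm\infty\}$ has nonzero Lebesgue measure; $\varpi:\mathcal K\to\mathbb R_{\ge0}$ is measurable with only finitely or countably infinitely many zeros. $\mathcal L^2_\varpi(\mathcal K;\mathbb R^d)$ is the set of measurable $\boldsymbol\phi:\mathcal K\to\mathbb R^d$ with $\int_{\mathcal K}\varpi\boldsymbol\phi^\top\boldsymbol\phi\,d\tau<\infty$. $\mathbb S^n$: real symmetric matrices; $\otimes$: Kronecker product. If $\delta=0$ all terms involving $\mathbf g$, $\boldsymbol e$ are void. *)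

(* Defs.v *)
From HB Require Import structures.
From mathcomp Require Import all_boot all_order all_algebra mxtens.
From mathcomp Require Import all_classical all_reals all_analysis.
From mathcomp Require Import measurable_realfun.

Set Implicit Arguments.
Unset Strict Implicit.
Unset Printing Implicit Defensive.

Import Order.TTheory GRing.Theory Num.Theory.
Local Open Scope classical_set_scope.
Local Open Scope ring_scope.

(* [elebesgue_measure] lives on the Borel sets of [\bar R] and gives
   {-oo, +oo} measure 0. [ext_line R] is [\bar R] with the Caratheodory
   sigma-algebra of that measure, so that "measurable" means Lebesgue
   measurable; the same construction on R gives the library's
   [completed_lebesgue_measure]. *)
Definition ext_line (R : realType) : measurableType _ :=
  caratheodory_type ((@elebesgue_measure R)^*)%mu.

Definition completed_elebesgue_measure {R : realType} :
    set (ext_line R) -> \bar R :=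
  @completed_measure_extension _ _ _ (@elebesgue_measure R).

HB.instance Definition _ (R : realType) :=
  Measure.on (@completed_elebesgue_measure R).

Notation elambda := completed_elebesgue_measure.

Definition mx_integral (R : realType) (K : set (ext_line R)) p q
    (M : ext_line R -> 'M[R]_(p, q)) : 'M[R]_(p, q) :=
  \matrix_(i, j) \int[elambda]_(t in K) M t i j.

(* A function on K is represented by a total function on the extended line
   whose values outside K are irrelevant. *)
Definition weighted_L2 (R : realType) (K : set (ext_line R))
    (w : ext_line R -> R) d : set (ext_line R -> 'cV[R]_d) :=
  [set phi : ext_line R -> 'cV[R]_d | (forall i : 'I_d, measurable_fun K (fun t => phi t i ord0)) /\
    (\int[elambda]_(t in K) (w t * ((phi t)^T *m phi t) ord0 ord0)%:E
      < +oo)%E].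

Definition psdmx (R : realType) n (A : 'M[R]_n) : Prop :=
  A \is symmetricmx /\
  forall v : 'cV[R]_n, 0 <= (v^T *m A *m v) ord0 ord0.

Definition pdmx (R : realType) n (A : 'M[R]_n) : Prop :=
  A \is symmetricmx /\
  forall v : 'cV[R]_n, v != 0 -> 0 < (v^T *m A *m v) ord0 ord0.

(* The Kronecker product of v with the identity matrix of size n; the cast
   only identifies 1 * n columns with n columns. *)
Definition kron_id (R : realType) d n (v : 'cV[R]_d) : 'M[R]_(d * n, n) :=
  castmx (erefl (d * n)%N, mul1n n) (tensmx v (1%:M : 'M[R]_n)).

(* Main.v *)
Require Import Defs.
From mathcomp Require Import all_boot all_order all_algebra mxtens.
From mathcomp Require Import all_classical all_reals all_analysis.
From mathcomp Require Import measurable_realfun.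
From mathcomp Require Import ring lra.

(** The statement is Bessel's inequality for the weighted pairing
    <u, v> = int_K w u v^T, which sends a pair of vector-valued functions to
    the matrix of scalar products of their components ([gram]).

    All products w u_i v_j of components of L2 functions are integrable
    ([prod_integrable]), so the pairing is linear in each argument for
    multiplication by constant matrices ([gram_mulmxl], [gram_subl]).  Given h
    with invertible Gram matrix H = <h, h>, subtract from x its orthogonal
    projection on the components of h: the [residual] is
    y = x - <x, h> H^-1 h, and <y, h> = 0, hence
    <y, y> = <x, x> - <x, h> H^-1 <h, x> ([gram_residual]).

    Both sides of the inequality are traces against U: the left one is
    tr (U <x, x>) ([energyE]), and a term built from h = f or h = e with the
    Kronecker product is tr (U <x, h> H^-1 <h, x>) ([kron_energyE]).  So
    passing from x to its residual lowers the energy by exactly the term of h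
    ([bessel_gap]).  This is applied twice.  The function e is the residual of
    g with respect to f, so it is orthogonal to f; thus removing from x its
    projection on f leaves <x, e> unchanged, and the second projection, on e,
    lowers the energy by the second term of the inequality.  What remains is
    the energy of a function, which is nonnegative because U is positive
    semidefinite and w is nonnegative ([energy_ge0]).

    The two Gram matrices are positive definite, hence invertible, because f
    and e arise from the stacked function (g, f) by the surjective constant
    matrices (0 1) and (1 -A) ([pdmx_congr]). *)

Set Implicit Arguments.
Unset Strict Implicit.
Unset Printing Implicit Defensive.

Import Order.TTheory GRing.Theory Num.Theory.
Local Open Scope classical_set_scope.
Local Open Scope ring_scope.

(** * Positive definite matrices and vectorized Kronecker products *)

Section MatrixFacts.
Variable R : realType.

Lemma symmetricmxP n (G : 'M[R]_n) : reflect (G = G^T) (G \is symmetricmx).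
Proof.
apply: (iffP (is_hermitianmxP _ _ _)) => /=;
  by rewrite expr0 scale1r map_mx_id.
Qed.

Lemma pdmx_unit n (G : 'M[R]_n) : pdmx G -> G \in unitmx.
Proof.
move=> [_ Gpos]; rewrite unitmxE unitfE; apply/negP => /det0P[v v_neq0 vG].
have /Gpos : v^T != 0 by rewrite -(inj_eq (@trmx_inj _ _ _)) trmxK trmx0.
by rewrite trmxK vG mul0mx mxE ltxx.
Qed.

(** The right inverse C of B makes B^T injective, so that v^T B G B^T v is the
    form of G at a nonzero vector. *)
Lemma pdmx_congr m n (B : 'M[R]_(m, n)) (C : 'M[R]_(n, m)) (G : 'M[R]_n) :
  B *m C = 1%:M -> pdmx G -> pdmx (B *m G *m B^T).
Proof.
move=> BC [/symmetricmxP Gsym Gpos]; split.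
  by apply/symmetricmxP; rewrite !trmx_mul trmxK -Gsym mulmxA.
move=> v v_neq0; rewrite !mulmxA -mulmxA -{1}[B]trmxK -trmx_mul.
apply: Gpos; apply: contraNneq v_neq0 => Bv.
by rewrite -[v]mul1mx -trmx1 -BC trmx_mul -mulmxA Bv mulmx0.
Qed.

(** Row-major vectorization as a column, indexed as the rows of [tensmx]. *)
Definition vec_tens m n (Z : 'M[R]_(m, n)) : 'cV[R]_(m * n) :=
  \col_p Z (mxtens_unindex p).1 (mxtens_unindex p).2.

Lemma sum_mxtens m n (F : 'I_(m * n) -> R) :
  \sum_p F p = \sum_(i < m) \sum_(k < n) F (mxtens_index (i, k)).
Proof.
rewrite pair_big (reindex (@mxtens_index m n)) /=; last first.
  by exists (@mxtens_unindex m n) => p _; rewrite (mxtens_indexK, mxtens_unindexK).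
by apply: eq_bigr => -[].
Qed.

Lemma vec_tensE m n (Z : 'M[R]_(m, n)) i k :
  vec_tens Z (mxtens_index (i, k)) ord0 = Z i k.
Proof. by rewrite mxE mxtens_indexK. Qed.

(** This vectorizes the rank-one matrix v y^T, so that integrating
    [kron_id n (h t) *m x t] produces the vectorization of a Gram matrix. *)
Lemma kron_id_mul d n (v : 'cV[R]_d) (y : 'cV[R]_n) :
  kron_id n v *m y = vec_tens (v *m y^T).
Proof.
apply/colP => p; case: (mxtens_indexP p) => i k.
rewrite vec_tensE mxE [RHS]mxE big_ord1 mxE.
under eq_bigr => l _.
  rewrite castmxE cast_ord_id.
  have -> : cast_ord (esym (mul1n n)) l = mxtens_index (ord0, l) by apply: val_inj.
  rewrite tensmxE mxE -mulrA mulr_natl mulrb.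
  over.
by rewrite -mulr_sumr -big_mkcond (big_pred1 k) // => l; rewrite eq_sym.
Qed.

Lemma tensmx_vec_tens m n (M : 'M[R]_m) (U : 'M[R]_n) (Z : 'M[R]_(m, n)) :
  tensmx M U *m vec_tens Z = vec_tens (M *m Z *m U^T).
Proof.
apply/colP => p; case: (mxtens_indexP p) => i k.
rewrite vec_tensE mxE sum_mxtens exchange_big mxE /=; apply: eq_bigr => l _.
rewrite !mxE mulr_suml; apply: eq_bigr => j _.
by rewrite tensmxE vec_tensE mulrAC.
Qed.

Lemma vec_tens_dot m n (Z W : 'M[R]_(m, n)) :
  ((vec_tens Z)^T *m vec_tens W) ord0 ord0 = \tr (Z^T *m W).
Proof.
rewrite mxE sum_mxtens /mxtrace exchange_big; apply: eq_bigr => k _.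
by rewrite mxE; apply: eq_bigr => i _; rewrite mxE !vec_tensE mxE.
Qed.

(** Turns the Kronecker-product quadratic form into a trace against U, the
    shape in which it can be compared with the energy of a function. *)
Lemma vec_tens_form m n (Z : 'M[R]_(m, n)) (M : 'M[R]_m) (U : 'M[R]_n) :
  ((vec_tens Z)^T *m tensmx M U *m vec_tens Z) ord0 ord0
  = \tr (U *m (Z^T *m M^T *m Z)).
Proof.
rewrite -mulmxA tensmx_vec_tens vec_tens_dot -[RHS]mxtrace_tr.
by rewrite !trmx_mul !trmxK !mulmxA.
Qed.

End MatrixFacts.

(** * Integrability of products of square-integrable components *)

Lemma Rintegral_sum (d : measure_display) (T : measurableType d)
    (R : realType) (mu : {measure set T -> \bar R}) (D : set T)
    (I : finType) (h : I -> T -> R) :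
  measurable D -> (forall i, mu.-integrable D (EFin \o h i)) ->
  \int[mu]_(t in D) (\sum_i h i t) = \sum_i \int[mu]_(t in D) h i t.
Proof.
move=> mD hint; rewrite /Rintegral.
under eq_integral do rewrite -sumEFin.
rewrite (integral_sum _ (f := fun i t => (h i t)%:E))// -sum_fine //.
by move=> i _; apply: integrable_fin_num => //; exact: hint.
Qed.

Lemma sqnormE (R : realType) p (v : 'cV[R]_p) :
  (v^T *m v) ord0 ord0 = \sum_i v i ord0 ^+ 2.
Proof. by rewrite mxE; apply: eq_bigr => i _; rewrite mxE expr2. Qed.

Section WeightedGram.
Variables (R : realType) (K : set (ext_line R)) (w : ext_line R -> R).
Hypotheses (mK : measurable K) (mw : measurable_fun K w).
Hypothesis w_ge0 : forall t, K t -> 0 <= w t.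

Lemma sqnorm_integrable p (u : ext_line R -> 'cV[R]_p) : weighted_L2 K w u ->
  elambda.-integrable K
    (EFin \o (fun t => w t * ((u t)^T *m u t) ord0 ord0)).
Proof.
move=> [mu uoo]; apply/integrableP; split.
  apply/measurable_EFinP; apply: measurable_funM => //.
  under eq_fun do rewrite sqnormE.
  apply: measurable_sum => i; exact: measurable_funX.
rewrite (le_lt_trans _ uoo)// le_eqVlt; apply/orP; left; apply/eqP.
apply: eq_integral => t /[!inE] Kt /=.
by rewrite ger0_norm// mulr_ge0 ?w_ge0// sqnormE sumr_ge0// => i _; rewrite sqr_ge0.
Qed.

(** Domination by |ab| <= a^2 + b^2. *)
Lemma prod_integrable p q (u : ext_line R -> 'cV[R]_p)
    (v : ext_line R -> 'cV[R]_q) i j :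
  weighted_L2 K w u -> weighted_L2 K w v ->
  elambda.-integrable K (EFin \o (fun t => w t * (u t i ord0 * v t j ord0))).
Proof.
move=> Lu Lv.
have comp_le r (z : 'cV[R]_r) k : z k ord0 ^+ 2 <= (z^T *m z) ord0 ord0.
  rewrite sqnormE (bigD1 k)//= lerDl sumr_ge0// => l _; exact: sqr_ge0.
apply: (le_integrable mK _ _
  (integrableD mK (sqnorm_integrable Lu) (sqnorm_integrable Lv))).
  apply/measurable_EFinP; apply: measurable_funM => //.
  by apply: measurable_funM; [apply: (proj1 Lu)|apply: (proj1 Lv)].
move=> t Kt /=; rewrite lee_fin -mulrDr !normrM.
apply: ler_wpM2l => //.
apply: le_trans (ler_norm _).
apply: le_trans (lerD (comp_le _ (u t) i) (comp_le _ (v t) j)).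
have := sqr_ge0 (`|u t i ord0| - `|v t j ord0|).
have := sqr_ge0 (`|u t i ord0| + `|v t j ord0|).
rewrite -(real_normK (num_real (u t i ord0))) -(real_normK (num_real (v t j ord0))).
nra.
Qed.

(** * The Gram pairing *)

Definition gram p q (u : ext_line R -> 'cV[R]_p) (v : ext_line R -> 'cV[R]_q) :
    'M[R]_(p, q) :=
  mx_integral K (fun t => w t *: (u t *m (v t)^T)).

Lemma gramE p q (u : ext_line R -> 'cV[R]_p) (v : ext_line R -> 'cV[R]_q) i j :
  gram u v i j = \int[elambda]_(t in K) (w t * (u t i ord0 * v t j ord0)).
Proof.
by rewrite mxE; apply: eq_Rintegral => t _; rewrite !mxE big_ord1 !mxE.
Qed.

Lemma tr_gram p q (u : ext_line R -> 'cV[R]_p) (v : ext_line R -> 'cV[R]_q) :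
  (gram u v)^T = gram v u.
Proof.
apply/matrixP => i j; rewrite mxE !gramE.
by apply: eq_Rintegral => t _; rewrite [u t _ _ * _]mulrC.
Qed.

(** The squared norm of [M *m u t] is a combination of the products of
    components of u, whose integrability is known. *)
Lemma weighted_L2_mulmx p q (M : 'M[R]_(q, p)) (u : ext_line R -> 'cV[R]_p) :
  weighted_L2 K w u -> weighted_L2 K w (fun t => M *m u t).
Proof.
move=> Lu; split.
  move=> i; under eq_fun do rewrite mxE.
  by apply: measurable_sum => k; apply: measurable_funM => //; apply: (proj1 Lu).
have : elambda.-integrable K (fun t => \sum_(i < q) \sum_(k < p) \sum_(l < p)
   ((M i k * M i l)%:E * (w t * (u t k ord0 * u t l ord0))%:E)%E)%E.
  do 3![apply: integrable_sum => // ? _].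
  by apply: integrableZl => //; exact: prod_integrable.
move=> /integrableP[_]; apply: le_lt_trans.
rewrite le_eqVlt; apply/orP; left; apply/eqP.
apply: eq_integral => t /[!inE] Kt /=.
rewrite -[LHS]gee0_abs; last first.
  by rewrite lee_fin mulr_ge0 ?w_ge0// sqnormE sumr_ge0// => i _; rewrite sqr_ge0.
congr (`| _ |)%E.
under eq_bigr do under eq_bigr do (under eq_bigr do rewrite -EFinM; rewrite sumEFin).
under eq_bigr do rewrite sumEFin.
rewrite sumEFin; congr EFin.
rewrite sqnormE mulr_sumr; apply: eq_bigr => i _.
rewrite !mxE expr2 mulr_suml mulr_sumr; apply: eq_bigr => k _.
rewrite !mulr_sumr; apply: eq_bigr => l _; ring.
Qed.

Lemma weighted_L2_col_mx p q (u : ext_line R -> 'cV[R]_p)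
    (v : ext_line R -> 'cV[R]_q) :
  weighted_L2 K w u -> weighted_L2 K w v ->
  weighted_L2 K w (fun t => col_mx (u t) (v t)).
Proof.
move=> Lu Lv; split.
  move=> i; case: (split_ordP i) => j ->.
    by under eq_fun do rewrite col_mxEu; apply: (proj1 Lu).
  by under eq_fun do rewrite col_mxEd; apply: (proj1 Lv).
have /integrableP[_] :=
  integrableD mK (sqnorm_integrable Lu) (sqnorm_integrable Lv).
apply: le_lt_trans; rewrite le_eqVlt; apply/orP; left; apply/eqP.
apply: eq_integral => t /[!inE] Kt.
rewrite tr_col_mx mul_row_col mxE mulrDr /= ger0_norm//.
rewrite -mulrDr mulr_ge0 ?w_ge0// !sqnormE addr_ge0// sumr_ge0// => i _;
  exact: sqr_ge0.
Qed.

Lemma gram_mulmxl p q r (M : 'M[R]_(r, p)) (u : ext_line R -> 'cV[R]_p)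
    (v : ext_line R -> 'cV[R]_q) :
  weighted_L2 K w u -> weighted_L2 K w v ->
  gram (fun t => M *m u t) v = M *m gram u v.
Proof.
move=> Lu Lv; apply/matrixP => i j; rewrite gramE mxE.
under eq_Rintegral => t _ do rewrite mxE mulr_suml mulr_sumr.
rewrite Rintegral_sum// => [|k].
  apply: eq_bigr => k _; rewrite gramE -RintegralZl//; last exact: prod_integrable.
  by apply: eq_Rintegral => t _; ring.
under eq_fun do rewrite -mulrA mulrCA.
exact: integrableZl (prod_integrable _ _ Lu Lv).
Qed.

Lemma gram_col_mx p q r (u : ext_line R -> 'cV[R]_p) (v : ext_line R -> 'cV[R]_q)
    (z : ext_line R -> 'cV[R]_r) :
  gram (fun t => col_mx (u t) (v t)) z = col_mx (gram u z) (gram v z).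
Proof.
apply/matrixP => i j; rewrite gramE mxE.
by case: (split_ordP i) => k ->; rewrite ?(unsplitK (inl _)) ?(unsplitK (inr _));
  rewrite gramE; apply: eq_Rintegral => t _; rewrite ?col_mxEu ?col_mxEd.
Qed.

(** Writing an affine correction as one constant matrix applied to a stacked
    function reduces additivity to linearity under matrix multiplication. *)
Lemma sub_mulmxE p q (N : 'M[R]_(p, q)) (u : ext_line R -> 'cV[R]_p)
    (h : ext_line R -> 'cV[R]_q) :
  (fun t => u t - N *m h t)
  = (fun t => row_mx 1%:M (- N) *m col_mx (u t) (h t)).
Proof. by apply/funext => t; rewrite mul_row_col mul1mx mulNmx. Qed.

Lemma weighted_L2_sub p q (N : 'M[R]_(p, q)) (u : ext_line R -> 'cV[R]_p)
    (h : ext_line R -> 'cV[R]_q) :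
  weighted_L2 K w u -> weighted_L2 K w h ->
  weighted_L2 K w (fun t => u t - N *m h t).
Proof.
by move=> Lu Lh; rewrite sub_mulmxE; apply/weighted_L2_mulmx/weighted_L2_col_mx.
Qed.

Lemma gram_subl p q r (N : 'M[R]_(p, q)) (u : ext_line R -> 'cV[R]_p)
    (h : ext_line R -> 'cV[R]_q) (v : ext_line R -> 'cV[R]_r) :
  weighted_L2 K w u -> weighted_L2 K w h -> weighted_L2 K w v ->
  gram (fun t => u t - N *m h t) v = gram u v - N *m gram h v.
Proof.
move=> Lu Lh Lv; have Luh := weighted_L2_col_mx Lu Lh.
rewrite sub_mulmxE (gram_mulmxl _ Luh Lv).
by rewrite gram_col_mx mul_row_col mul1mx mulNmx.
Qed.

Lemma gram_mulmx2 p r (M : 'M[R]_(r, p)) (u : ext_line R -> 'cV[R]_p) :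
  weighted_L2 K w u ->
  gram (fun t => M *m u t) (fun t => M *m u t) = M *m gram u u *m M^T.
Proof.
move=> Lu; have LMu := weighted_L2_mulmx M Lu.
by rewrite gram_mulmxl// -tr_gram gram_mulmxl// trmx_mul tr_gram mulmxA.
Qed.

(** * The energy of a function and its Kronecker terms *)

Lemma energyE n (U : 'M[R]_n) (x : ext_line R -> 'cV[R]_n) :
  weighted_L2 K w x ->
  mx_integral K (fun t => w t *: ((x t)^T *m U *m x t)) ord0 ord0
  = \tr (U *m gram x x).
Proof.
move=> Lx; rewrite -gram_mulmxl// mxE /mxtrace.
under [RHS]eq_bigr do rewrite gramE.
rewrite -Rintegral_sum// => [|k]; last first.
  exact: prod_integrable (weighted_L2_mulmx U Lx) Lx.
apply: eq_Rintegral => t _.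
rewrite -mulmxA mxE mxE mulr_sumr; apply: eq_bigr => k _.
by rewrite [_^T _ _]mxE [_ * (U *m _) _ _]mulrC.
Qed.

Lemma energy_ge0 n (U : 'M[R]_n) (x : ext_line R -> 'cV[R]_n) :
  psdmx U -> weighted_L2 K w x -> 0 <= \tr (U *m gram x x).
Proof.
move=> [_ Upos] Lx; rewrite -energyE// mxE; apply: Rintegral_ge0 => t Kt.
by rewrite mxE mulr_ge0 ?w_ge0.
Qed.

Lemma kron_energyE d n (M : 'M[R]_d) (U : 'M[R]_n)
    (h : ext_line R -> 'cV[R]_d) (x : ext_line R -> 'cV[R]_n) :
  (mx_integral K (fun t => w t *: ((x t)^T *m (kron_id n (h t))^T))
     *m tensmx M U
     *m mx_integral K (fun t => w t *: (kron_id n (h t) *m x t))) ord0 ord0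
  = \tr (U *m (gram x h *m M^T *m gram h x)).
Proof.
have -> : mx_integral K (fun t => w t *: (kron_id n (h t) *m x t))
    = vec_tens (gram h x).
  apply/matrixP => i j; rewrite !mxE; apply: eq_Rintegral => t _.
  by rewrite kron_id_mul !mxE.
have -> : mx_integral K (fun t => w t *: ((x t)^T *m (kron_id n (h t))^T))
    = (vec_tens (gram h x))^T.
  apply/matrixP => i j; rewrite !mxE; apply: eq_Rintegral => t _.
  by rewrite -trmx_mul kron_id_mul !mxE.
by rewrite vec_tens_form tr_gram.
Qed.

(** * Orthogonal projection and Bessel's inequality *)

Definition residual p q (x : ext_line R -> 'cV[R]_p) (h : ext_line R -> 'cV[R]_q)
    : ext_line R -> 'cV[R]_p :=
  fun t => x t - gram x h *m invmx (gram h h) *m h t.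

Section Residual.
Variables (p q : nat).
Variables (x : ext_line R -> 'cV[R]_p) (h : ext_line R -> 'cV[R]_q).
Hypotheses (Lx : weighted_L2 K w x) (Lh : weighted_L2 K w h).
Hypothesis h_unit : gram h h \in unitmx.

Lemma weighted_L2_residual : weighted_L2 K w (residual x h).
Proof. exact: weighted_L2_sub. Qed.

Lemma gram_residual_orth : gram (residual x h) h = 0.
Proof. by rewrite gram_subl// mulmxKV// subrr. Qed.

(** Pythagoras: since the residual y is orthogonal to h, <y, y> = <x, y>. *)
Lemma gram_residual :
  gram (residual x h) (residual x h)
  = gram x x - gram x h *m invmx (gram h h) *m gram h x.
Proof.
have Ly := weighted_L2_residual.
transitivity (gram x (residual x h)).
  rewrite (gram_subl _ Lx Lh Ly) -[gram h (residual x h)]tr_gram.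
  by rewrite gram_residual_orth trmx0 mulmx0 subr0.
rewrite -tr_gram (gram_subl _ Lx Lh Lx) linearB /= tr_gram.
by rewrite !trmx_mul trmx_inv !tr_gram mulmxA.
Qed.

(** An equality, not an inequality: the remainder is the energy of another
    function, to which a further projection can be applied. *)
Lemma bessel_gap (U : 'M[R]_p) :
  \tr (U *m gram x x)
  = \tr (U *m (gram x h *m invmx (gram h h) *m gram h x))
    + \tr (U *m gram (residual x h) (residual x h)).
Proof. by rewrite gram_residual mulmxBr raddfB /= addrC subrK. Qed.

End Residual.

End WeightedGram.

Theorem lemma5p2 (R : realType) (K : set (ext_line R)) (w : ext_line R -> R)
    (mK : measurable K) (K_neq0 : elambda K != 0%E)
    (mw : measurable_fun K w) (w_ge0 : forall t, K t -> 0 <= w t)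
    (w_zeros : countable [set t | K t /\ w t = 0])
    (n d delta : nat) (n_gt0 : (0 < n)%N) (d_gt0 : (0 < d)%N)
    (U : 'M[R]_n) (U_psd : psdmx U)
    (f : ext_line R -> 'cV[R]_d) (g : ext_line R -> 'cV[R]_delta)
    (f_L2 : weighted_L2 K w f) (g_L2 : weighted_L2 K w g)
    (gf_pd : pdmx (mx_integral K (fun t =>
       w t *: (col_mx (g t) (f t) *m row_mx (g t)^T (f t)^T)))) :
  let Gf := mx_integral K (fun t => w t *: (f t *m (f t)^T)) in
  let Fd := invmx Gf in
  let A := mx_integral K (fun t => w t *: (g t *m (f t)^T)) *m Fd in
  let e := fun t => g t - A *m f t in
  let Ed := mx_integral K (fun t => w t *: (e t *m (e t)^T)) in
  let F := fun t => kron_id n (f t) in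
  let E := fun t => kron_id n (e t) in
  [/\ pdmx Gf, Ed \is symmetricmx, Ed \in unitmx
    & forall x : ext_line R -> 'cV[R]_n, weighted_L2 K w x ->
      (mx_integral K (fun t => w t *: ((x t)^T *m U *m x t))) ord0 ord0 >=
      (mx_integral K (fun t => w t *: ((x t)^T *m (F t)^T))
         *m tensmx Fd U
         *m mx_integral K (fun t => w t *: (F t *m x t))) ord0 ord0
      + (mx_integral K (fun t => w t *: ((x t)^T *m (E t)^T))
         *m tensmx (invmx Ed) U
         *m mx_integral K (fun t => w t *: (E t *m x t))) ord0 ord0].
Proof.
move=> Gf Fd A e Ed F E.
have Lh := weighted_L2_col_mx mK mw w_ge0 g_L2 f_L2.
set h := (fun t => col_mx (g t) (f t)) in Lh.
have h_pd : pdmx (gram K w h h).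
  move: gf_pd; congr pdmx; congr mx_integral; apply/funext => t.
  by rewrite /h tr_col_mx.
have Gf_pd : pdmx Gf.
  have -> : Gf = row_mx 0 1%:M *m gram K w h h *m (row_mx 0 1%:M)^T.
    rewrite -gram_mulmx2//; congr mx_integral; apply/funext => t.
    by rewrite /h mul_row_col mul0mx add0r mul1mx.
  apply: (pdmx_congr (C := col_mx 0 1%:M)) h_pd.
  by rewrite mul_row_col mul0mx add0r mul1mx.
have Gf_unit := pdmx_unit Gf_pd.
have Le : weighted_L2 K w e by exact: weighted_L2_residual.
have Ed_pd : pdmx Ed.
  have -> : Ed = row_mx 1%:M (- A) *m gram K w h h *m (row_mx 1%:M (- A))^T.
    by rewrite -gram_mulmx2// -sub_mulmxE.
  apply: (pdmx_congr (C := col_mx 1%:M 0)) h_pd.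
  by rewrite mul_row_col mulmx0 addr0 mul1mx.
have Ed_unit := pdmx_unit Ed_pd.
split => //; first by case: Ed_pd.
move=> x Lx.
rewrite energyE// !kron_energyE !trmx_inv.
have -> : Gf^T = Gf by exact: tr_gram.
have -> : Ed^T = Ed by exact: tr_gram.
rewrite (bessel_gap mK mw w_ge0 Lx f_L2 Gf_unit) lerD2l.
(* After the projection on f, the second term is the one that e removes
   from the residual y, because <y, e> = <x, e>. *)
set y := residual K w x f.
have Ly : weighted_L2 K w y by exact: weighted_L2_residual.
have f_orth_e : gram K w f e = 0.
  by rewrite -tr_gram (gram_residual_orth mK mw w_ge0 g_L2 f_L2 Gf_unit) trmx0.
have ye : gram K w y e = gram K w x e.
  by rewrite gram_subl// f_orth_e mulmx0 subr0.
have ey : gram K w e y = gram K w e x by rewrite -tr_gram ye tr_gram.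
rewrite (bessel_gap mK mw w_ge0 Ly Le Ed_unit) ye ey lerDl.
exact: energy_ge0 (weighted_L2_residual mK mw w_ge0 Ly Le).
Qed.
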